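(* Let $D,\Omega,H,P$, $\varphi$ and the functionals $\mathcal F,\mathcal G$ be as in the context. (Cloaking) Let $p$ be the pressure in the definition of $\mathcal F$. Let $\{p_k\}$ and $\{\varphi_k\}$ be sequences such that $\frac{\partial p_k}{\partial\nu}\to\frac{\partial p}{\partial\nu}$ and $\frac{\partial\varphi_k}{\partial\nu}\to\frac{\partial\varphi}{\partial\nu}$ in $L^2(\partial\Omega)$ as $k\to\infty$, and let $\zeta_{0,opt}^{(k)}$ be a minimizer over $[a,b]$ of the functional $\mathcal F$ with $\varphi$ and $p$ replaced by $\varphi_k$ and $p_k$. Then the optimal zeta potential is stable with respect to $\varphi$ and $p$, i.e. $\zeta_{0,opt}^{(k)}\to\zeta_{0,opt}$, where $\zeta_{0,opt}$ is the minimizer of $\mathcal F$ over $[a,b]$. (Shielding) The same holds with $\mathcal F$ and $[a,b]$ replaced by $\mathcal G$ and $[c,d]$, where $p$ is now the pressure in the definition of $\mathcal G$.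
   Context: $\Omega\subset\mathbb{R}^2$ is a bounded domain and $D$ is a domain with $\overline D\subset\Omega$, both of class $C^{1,\alpha}$ for some $0<\alpha<1$; $H,P$ are harmonic functions on $\mathbb{R}^2$ (background fields); $[a,b],[c,d]\subset\mathbb{R}$ are given intervals; $\nu$ is the outward unit normal. The potential $\varphi$ solves $\Delta\varphi=0$ in $\mathbb{R}^2\setminus\overline D$, $\partial\varphi/\partial\nu=0$ on $\partial D$, $\varphi=H(x)+O(|x|^{-1})$ as $|x|\to\infty$. Cloaking functional: $$\mathcal F(\zeta_0)=\Big\|\frac{\partial P}{\partial\nu}-\frac{\partial p}{\partial\nu}-12\zeta_0\frac{\partial\varphi}{\partial\nu}\Big\|^2_{L^2(\partial\Omega)},\quad\zeta_0\in[a,b],$$ where $p$ solves $\Delta p=0$ in $\Omega\setminus\overline D$, $\partial p/\partial\nu=0$ on $\partial D$, $p=P$ on $\partial\Omega$. Shielding functional: $$\mathcal G(\zeta_0)=\Big\|\frac{\partial p}{\partial\nu}-12\zeta_0\frac{\partial\varphi}{\partial\nu}\Big\|^2_{L^2(\partial\Omega)},\quad\zeta_0\in[c,d],$$ where $p$ solves $\Delta p=0$ in $\mathbb{R}^2\setminus\overline\Omega$, $p=0$ on $\partial\Omega$, $p=P(x)+O(|x|^{-1})$ as $|x|\to\infty$. In each case $\zeta_{0,opt}$ denotes the (unique) minimizer of the functional over its interval. *)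

(* Defs.v *)
From HB Require Import structures.
From mathcomp Require Import all_boot all_order all_algebra.
From mathcomp Require Import all_classical all_reals all_analysis.
Import Order.TTheory GRing.Theory Num.Theory.
Import numFieldNormedType.Exports.

Set Implicit Arguments.
Unset Strict Implicit.
Unset Printing Implicit Defensive.

Local Open Scope classical_set_scope.
Local Open Scope ring_scope.

Notation plane R := 'rV[R]_2.

(* The library norm on ['rV[R]_2] is the sup norm: it gives the right topology,
   but lengths, angles and unit normals need the Euclidean structure. *)
Section Euclidean.
Context {R : realType}.

Definition dot (u v : plane R) : R := \sum_(i < 2) u 0 i * v 0 i.

Definition enorm (u : plane R) : R := Num.sqrt (dot u u).

Definition orthonormal2 (e n : plane R) : Prop :=
  [/\ dot e e = 1, dot n n = 1 & dot e n = 0].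

Definition boundary (A : set (plane R)) : set (plane R) := closure A `\` A°.

End Euclidean.

Section Domains.
Context {R : realType}.
Implicit Types (A : set (plane R)) (e n x z : plane R) (gamma : R -> R).

Definition C1_fun gamma : Prop :=
  (forall s, derivable gamma s 1) /\ continuous (derive1 gamma).

Definition C1_holder_fun (alpha : R) gamma : Prop :=
  C1_fun gamma /\
  exists K, forall s t, `|derive1 gamma s - derive1 gamma t| <= K * `|s - t| `^ alpha.

(* In the disc of radius [r] around [z], and in the coordinates given by the
   orthonormal frame [(e, n)], the set [A] is the region above the graph. *)
Definition local_epigraph A z (r : R) e n gamma : Prop :=
  [/\ 0 < r, orthonormal2 e n &
      forall x, enorm (x - z) < r -> (A x <-> gamma (dot x e) < dot x n)].

Definition C1_holder_domain (alpha : R) A : Prop :=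
  [/\ open A, connected A, A !=set0 &
      forall z, boundary A z -> exists r e n gamma,
        C1_holder_fun alpha gamma /\ local_epigraph A z r e n gamma].

Definition is_outward_normal A x (v : plane R) : Prop :=
  exists r e n gamma, [/\ C1_fun gamma, local_epigraph A x r e n gamma &
    let g := derive1 gamma (dot x e) in
    v = (Num.sqrt (1 + g ^+ 2))^-1 *: (g *: e - n)].

Definition outward_normal A x : plane R := xget 0 (is_outward_normal A x).

End Domains.

(* One-dimensional Hausdorff measure; on a C^1 curve it is the arc length. *)
Section ArcLength.
Context {R : realType}.
Local Open Scope ereal_scope.
Implicit Types (A B C : set (plane R)) (delta : R).

(* [0] is adjoined so that the empty set has diameter [0] and not [-oo]. *)
Definition diameter C : \bar R :=
  ereal_sup (0 |` [set (enorm (u.1 - u.2))%:E | u in C `*` C]).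

Definition hausdorff1_premeasure delta A : \bar R :=
  ereal_inf [set \sum_(k <oo) diameter (C k) | C in
    [set C : (set (plane R))^nat |
      A `<=` \bigcup_k C k /\ forall k, diameter (C k) <= delta%:E]].

Definition hausdorff1 A : \bar R :=
  ereal_sup [set hausdorff1_premeasure delta A | delta in [set d | (0 < d)%R]].

(* Restricting the outer measure before applying Caratheodory's construction
   makes the complement of [B] null, hence measurable, whatever [B] is. *)
Definition hausdorff1_on B A : \bar R := hausdorff1 (A `&` B).

Lemma diameter_ge0 C : 0 <= diameter C.
Proof. by apply: ereal_sup_ubound; left. Qed.

Lemma diameter0 : diameter set0 = 0.
Proof.
apply/eqP; rewrite eq_le diameter_ge0 andbT; apply: ge_ereal_sup.
by move=> _ [->//|[u [[]]]].
Qed.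

(* Gauge turning the mesh restriction into an infinite cost, so that
   [hausdorff1_premeasure] becomes an instance of [mu_ext]. *)
Let gauge delta (C : set (g_sigma_algebraType [set: set (plane R)])) : \bar R :=
  if diameter C <= delta%:E then diameter C else +oo.

Let gauge_ge0 delta C : 0 <= gauge delta C.
Proof. by rewrite /gauge; case: ifP => // _; exact: diameter_ge0. Qed.

Let premeasureE delta A : hausdorff1_premeasure delta A = mu_ext (gauge delta) A.
Proof.
have mT (C : set (g_sigma_algebraType [set: set (plane R)])) : measurable C.
  exact: sub_sigma_algebra.
apply/eqP; rewrite eq_le; apply/andP; split; apply: le_ereal_inf_tmp => y /=.
  move=> [C [_ AC] <-].
  have [Cd|] := pselect (forall k, diameter (C k) <= delta%:E).
    apply: ereal_inf_lbound; exists C; first by split.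
    by apply: eq_eseriesr => k _; rewrite /gauge Cd.
  move=> /existsNP[k /negP Ck].
  have gCk : gauge delta (C k) = +oo by rewrite /gauge (negbTE Ck).
  rewrite (eseries_pinfty _ _ gCk) ?leey// => n _.
  by rewrite -ltNye (lt_le_trans _ (gauge_ge0 _ _)).
move=> [C [AC Cd] <-].
apply: ereal_inf_lbound; exists C; first by split=> // k; exact: mT.
by apply: eq_eseriesr => k _; rewrite /gauge Cd.
Qed.

Let hausdorff1_ge0 A : 0 <= hausdorff1 A.
Proof.
apply: (@le_trans _ _ (hausdorff1_premeasure 1 A)).
  by rewrite premeasureE; apply: mu_ext_ge0 => C; exact: gauge_ge0.
by apply: ereal_sup_ubound; exists 1%R => //=.
Qed.

Lemma hausdorff1_on0 B : hausdorff1_on B set0 = 0.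
Proof.
apply/eqP; rewrite eq_le hausdorff1_ge0 andbT; apply: ge_ereal_sup.
move=> _ [d /= d0 <-]; rewrite set0I premeasureE mu_ext0//.
by rewrite /gauge diameter0 lee_fin ltW.
Qed.

Lemma hausdorff1_on_ge0 B A : 0 <= hausdorff1_on B A.
Proof. exact: hausdorff1_ge0. Qed.

Lemma le_hausdorff1_on B :
  {homo hausdorff1_on B : A A' / A `<=` A' >-> A <= A'}.
Proof.
move=> A A' AA'; apply: ge_ereal_sup => _ [d /= d0 <-].
apply: (@le_trans _ _ (hausdorff1_premeasure d (A' `&` B))).
  by rewrite !premeasureE; apply: le_mu_ext; exact: setSI.
by apply: ereal_sup_ubound; exists d.
Qed.

Lemma hausdorff1_on_sigma_subadditive B : sigma_subadditive (hausdorff1_on B).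
Proof.
move=> F; apply: ge_ereal_sup => _ [d /= d0 <-].
rewrite premeasureE setI_bigcupl.
apply: (@le_trans _ _ (\sum_(k <oo) mu_ext (gauge d) (F k `&` B))).
  exact: (@mu_ext_sigma_subadditive _ (g_sigma_algebraType [set: set (plane R)]) R
    _ (gauge_ge0 d) (fun k => F k `&` B)).
apply: lee_nneseries => [k _ _|k _].
  by apply: mu_ext_ge0 => C; exact: gauge_ge0.
by rewrite -premeasureE; apply: ereal_sup_ubound; exists d.
Qed.

HB.instance Definition _ B := isOuterMeasure.Build R (plane R)
  (hausdorff1_on B) (hausdorff1_on0 B) (hausdorff1_on_ge0 B)
  (@le_hausdorff1_on B) (@hausdorff1_on_sigma_subadditive B).

Definition arc_length_outer A : {outer_measure set (plane R) -> \bar R} :=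
  hausdorff1_on (boundary A).

(* Arc length on [boundary A], as a measure on the sigma-algebra of the
   Caratheodory-measurable sets. *)
Definition arc_length A :
    {measure set (caratheodory_type (arc_length_outer A)) -> \bar R} :=
  arc_length_outer A.

End ArcLength.

Section Potentials.
Context {R : realType}.
Implicit Types (A U : set (plane R)) (u v H P phi p : plane R -> R).

Definition basis_vec (i : 'I_2) : plane R := delta_mx 0 i.

Definition C1_on U u : Prop := forall x, U x -> forall i,
  derivable u x (basis_vec i) /\ {for x, continuous ('D_(basis_vec i) u)}.

Definition C2_on U u : Prop :=
  C1_on U u /\ forall i, C1_on U ('D_(basis_vec i) u).

Definition laplacian u x : R := \sum_(i < 2) 'D_(basis_vec i) ('D_(basis_vec i) u) x.

Definition harmonic_on U u : Prop :=
  C2_on U u /\ forall x, U x -> laplacian u x = 0.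

(* [u] and its gradient extend continuously from the open set [U] to its
   closure, the extension of [u] being [u] itself. *)
Definition C1_up_to_closure U u : Prop :=
  C1_on U u /\ forall x, closure U x ->
    u y @[y --> within U (nbhs x)] --> u x /\
    forall i, cvg ('D_(basis_vec i) u y @[y --> within U (nbhs x)]).

Definition normal_quotient A u x (h : R) : R :=
  h^-1 * (u (x + h *: outward_normal A x) - u x).

(* Normal derivative on [boundary A] along the filter [F] on the step [h]:
   [0^'-] is the derivative from inside [A], [0^'+] the one from outside, and
   [0^'] the two-sided one, for functions defined on both sides. *)
Definition has_normal_derivative (F : set_system R) A u x : Prop :=
  cvg (normal_quotient A u x @ F).

Definition normal_derivative (F : set_system R) A u x : R :=
  lim (normal_quotient A u x @ F).

(* [u x = v x + O(1 / |x|)] as [|x|] tends to infinity *)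
Definition far_field u v : Prop :=
  exists C M : R, forall x, M <= enorm x -> `|u x - v x| <= C / enorm x.

Definition electric_potential (D : set (plane R)) H phi : Prop :=
  let U := ~` closure D in
  [/\ harmonic_on U phi, C1_up_to_closure U phi,
      forall x, boundary D x ->
        has_normal_derivative 0^'+ D phi x /\
        normal_derivative 0^'+ D phi x = 0 &
      far_field phi H].

Definition cloaking_pressure (Omega D : set (plane R)) P p : Prop :=
  let U := Omega `\` closure D in
  [/\ harmonic_on U p, C1_up_to_closure U p,
      forall x, boundary D x ->
        has_normal_derivative 0^'+ D p x /\
        normal_derivative 0^'+ D p x = 0 &
      forall x, boundary Omega x -> p x = P x].

Definition shielding_pressure (Omega : set (plane R)) P p : Prop :=
  let U := ~` closure Omega in
  [/\ harmonic_on U p, C1_up_to_closure U p,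
      forall x, boundary Omega x -> p x = 0 &
      far_field p P].

End Potentials.

Section Functionals.
Context {R : realType}.
Implicit Types (Omega : set (plane R)) (P phi p u : plane R -> R).

Definition sqr_L2norm Omega (f : plane R -> R) : \bar R :=
  ('N[arc_length Omega]_2%:E[EFin \o f] ^+ 2)%E.

Definition cloaking_functional Omega P phi p (zeta : R) : \bar R :=
  sqr_L2norm Omega (fun x => normal_derivative 0^' Omega P x
    - normal_derivative 0^'- Omega p x
    - 12 * zeta * normal_derivative 0^' Omega phi x).

Definition shielding_functional Omega phi p (zeta : R) : \bar R :=
  sqr_L2norm Omega (fun x => normal_derivative 0^'+ Omega p x
    - 12 * zeta * normal_derivative 0^' Omega phi x).

Definition minimizer (a b : R) (J : R -> \bar R) (z : R) : Prop :=
  z \in `[a, b] /\ forall z', z' \in `[a, b] -> (J z <= J z')%E.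

Definition unique_minimizer (a b : R) (J : R -> \bar R) (z : R) : Prop :=
  forall z', minimizer a b J z' <-> z' = z.

Definition cvg_L2 Omega (f_ : (plane R -> R)^nat) (f : plane R -> R) : Prop :=
  [/\ forall k, f_ k \in Lfun (arc_length Omega) 2%:E,
      f \in Lfun (arc_length Omega) 2%:E &
      'N[arc_length Omega]_2%:E[EFin \o (f_ k \- f)%R]%E @[k --> \oo] --> 0%E].

Definition cvg_normal_derivative (F : set_system R) Omega
    (u_ : (plane R -> R)^nat) u : Prop :=
  (forall k, {ae arc_length Omega, forall x,
     boundary Omega x -> has_normal_derivative F Omega (u_ k) x}) /\
  cvg_L2 Omega (fun k => normal_derivative F Omega (u_ k))
               (normal_derivative F Omega u).

End Functionals.

(* Main.v *)
(* Only the triangle inequality matters: the functionals are squared L^2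
   distances, so changing the data changes the distances, uniformly on the
   interval, by at most the L^2 size of the change, and every limit point of the
   perturbed minimizers minimizes the limit functional, which has only one
   minimizer.  The normal derivative of P is never shown to be measurable: the
   integral of a nonnegative function is a supremum over simple minorants, and
   this lower integral satisfies the triangle inequality as soon as the
   perturbation is measurable. *)
Require Import Defs.
From mathcomp Require Import all_boot all_order all_algebra.
From mathcomp Require Import all_classical all_reals all_analysis.
From mathcomp Require Import measurable_realfun lra.
Import Order.TTheory GRing.Theory Num.Theory.
Import numFieldNormedType.Exports.
Local Open Scope classical_set_scope.
Local Open Scope ring_scope.

(** * Lower integrals and a triangle inequality for them *)

Section lower_integral.
Context d (T : measurableType d) (R : realType).
Variable mu : {measure set T -> \bar R}.
Local Open Scope ereal_scope.

Import HBNNSimple.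

(** Every simple minorant of [f] is one of [g], so the supremum for [g] runs over a larger set. *)
Lemma ge0_le_lower_integral (f g : T -> \bar R) :
  (forall x, 0 <= f x) -> (forall x, f x <= g x) ->
  \int[mu]_x f x <= \int[mu]_x g x.
Proof.
move=> f0 fg.
rewrite !ge0_integralTE//; last by move=> x; exact: le_trans (f0 x) (fg x).
apply: ereal_sup_le => _ [h /= hf <-]; exists h => //= x.
exact: le_trans (hf x) (fg x).
Qed.

Lemma le_Lnorm (r : R) (f g : T -> \bar R) : (0 < r)%R ->
  (forall x, `|f x| <= `|g x|) -> 'N[mu]_r%:E[f] <= 'N[mu]_r%:E[g].
Proof.
move=> r0 fg; rewrite unlock /Lnorm.
apply: gt0_ler_poweR; rewrite ?invr_ge0 ?(ltW r0)//.
- by rewrite in_itv/= leey andbT integral_ge0// => x _; exact: poweR_ge0.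
- by rewrite in_itv/= leey andbT integral_ge0// => x _; exact: poweR_ge0.
apply: ge0_le_lower_integral => x; first exact: poweR_ge0.
by apply: gt0_ler_poweR; rewrite ?in_itv/= ?leey ?abse_ge0 ?(ltW r0).
Qed.

(* [f] and [g] need not be measurable: a minorant [h] of [|f|] gives the
   measurable minorant [max (h - |w|) 0] of [|g|]. *)
Lemma Lnorm_le_add_measurable (r : R) (f g w : T -> R) : (1 <= r)%R ->
  measurable_fun setT w -> (forall x, `|f x| <= `|g x| + `|w x|)%R ->
  'N[mu]_r%:E[EFin \o f] <= 'N[mu]_r%:E[EFin \o g] + 'N[mu]_r%:E[EFin \o w].
Proof.
move=> r1 mw fgw; have r0 : (0 < r)%R by exact: lt_le_trans r1.
set N := _ + _.
have N0 : 0 <= N by apply: adde_ge0; exact: Lnorm_ge0.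
(* After raising to the power [r], the left side is a supremum over simple minorants [s] of [|f|^r],
   which can be bounded one at a time. *)
suff: 'N[mu]_r%:E[EFin \o f] `^ r <= N `^ r.
  move=> fN; rewrite -[leLHS]poweRe1 ?Lnorm_ge0// -[leRHS]poweRe1//.
  rewrite -(mulfV (lt0r_neq0 r0)) !poweRrM.
  by apply: gt0_ler_poweR;
    rewrite ?in_itv/= ?leey ?andbT ?poweR_ge0 ?invr_ge0 ?(ltW r0).
rewrite poweR_Lnorm ?gt_eqF// ge0_integralTE; last by move=> x; exact: poweR_ge0.
apply: ge_ereal_sup => _ [s /= sf <-].
pose h x : R := (s x `^ r^-1)%R.
have mh : measurable_fun setT h.
  by apply: (@measurableT_comp _ _ _ _ _ _ (@powR R ^~ r^-1%R)).
have hE x : (h x `^ r = s x)%R.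
  by rewrite -powRrM mulVf ?gt_eqF// powRr1.
have hf x : (h x <= `|f x|)%R.
  rewrite -[leRHS]powRr1// -(mulfV (lt0r_neq0 r0)) powRrM.
  apply: ge0_ler_powR; rewrite ?nnegrE ?invr_ge0 ?powR_ge0 ?(ltW r0)//.
  by have := sf x; rewrite /= lee_fin.
pose m x : R := Num.max (h x - `|w x|)%R 0%R.
have mabs : measurable_fun setT (fun x => `|w x|)%R.
  exact: measurableT_comp.
have mm : measurable_fun setT m.
  by apply: measurable_maxr => //; exact: measurable_funB.
have -> : sintegral mu s = 'N[mu]_r%:E[EFin \o h] `^ r.
  rewrite poweR_Lnorm ?gt_eqF// -integralT_nnsfun.
  by apply: eq_integral => x _ /=; rewrite ger0_norm ?powR_ge0// hE.
apply: gt0_ler_poweR; rewrite ?in_itv/= ?leey ?andbT ?Lnorm_ge0 ?(ltW r0)//.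
(* Minkowski applies to the measurable functions [m] and [|w|], between the pointwise bounds
   [h <= m + |w|] and [m <= |g|]. *)
apply: (@le_trans _ _ ('N[mu]_r%:E[EFin \o (m \+ (fun x => `|w x|))%R])).
  apply: le_Lnorm => // x /=; rewrite lee_fin ger0_norm ?powR_ge0//.
  apply: le_trans (ler_norm _).
  by rewrite -lerBlDr le_max lexx.
apply: le_trans (minkowski_EFin _ mm mabs r1) _.
apply: leeD; apply: le_Lnorm => // x /=; rewrite lee_fin; last by rewrite normr_id.
rewrite ger0_norm ?le_max ?lexx ?orbT// ge_max normr_ge0 andbT.
by rewrite lerBlDr (le_trans (hf x)).
Qed.

End lower_integral.

(** * Stability of minimizers on a compact interval *)

Section argmin.
Context {R : realType}.
Implicit Types (a b z : R).

(** Squaring is strictly increasing on nonnegative values. This trades the squared norms for the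
    norms, which obey the triangle inequality. *)
Lemma minimizer_sqr a b (J : R -> \bar R) z : (forall x, 0 <= J x)%E ->
  minimizer a b (fun x => J x ^+ 2)%E z <-> minimizer a b J z.
Proof.
move=> J0; split=> -[zab Jz]; split=> // z' /Jz; rewrite !leNgt.
- by rewrite lte_sqr.
- by rewrite lte_sqr.
Qed.

(** A point [z] of the interval other than [zeta] exceeds the minimum by a gap, and the two bounds
    then keep [zeta_ k] away from a neighbourhood of [z] for large [k]. Compactness makes this
    uniform outside any neighbourhood of [zeta]. *)
Lemma cvg_argmin a b (J : R -> \bar R) (J_ : nat -> R -> \bar R)
    (e : nat -> \bar R) (M : R) zeta (zeta_ : nat -> R) :
  (forall k z z', z' \in `[a, b] ->
    J z <= J_ k z' + (e k + (M * `|z - z'|)%:E))%E ->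
  (forall k z, z \in `[a, b] -> J_ k z <= J z + e k)%E ->
  e k @[k --> \oo] --> 0%E ->
  unique_minimizer a b J zeta ->
  (forall k, minimizer a b (J_ k) (zeta_ k)) ->
  zeta_ k @[k --> \oo] --> zeta.
Proof.
move=> JJ_ J_J e0 uniq zeta_min.
have [zab zmin] : minimizer a b J zeta by apply/uniq.
move=> U; rewrite nbhsE => -[V [oV Vz] VU].
have cK : compact (`[a, b]%classic `\` V).
  apply: (@subclosed_compact _ _ `[a, b]%classic).
  - by apply: closedI; [exact: itv_closed | exact: open_closedC].
  - exact: segment_compact.
  - by move=> x [].
move/compact_near_coveringP : cK => /(_ nat \oo (fun k z => zeta_ k <> z)) cK.
suff /cK cK' : forall x, (`[a, b]%classic `\` V) x ->
    \forall x' \near x & k \near \oo, zeta_ k <> x'.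
  rewrite /= nbhs_simpl /=; near=> k; apply: VU; apply: contrapT => nV.
  have : `[a, b]%classic `\` V `<=` (fun z => zeta_ k <> z) by near: k; exact: cK'.
  by move=> /(_ (zeta_ k)); apply => //; split => //; have [] := zeta_min k.
move=> z [/= zI nVz].
(* Without such a gap [z] would be a second minimizer of [J]. *)
have [dlt dlt0 Jdlt] : exists2 dlt : R, 0 < dlt & ~ (J z <= J zeta + dlt%:E)%E.
  apply: contrapT => H; apply: nVz.
  suff -> : z = zeta by [].
  apply/uniq; split => // z' z'ab; apply: le_trans (zmin z' z'ab).
  apply/lee_addgt0Pr => r r0; apply: contrapT => Hr; apply: H; by exists r.
(* The sign of [M] is unconstrained and [M] may vanish, so [|M| + 1] serves as divisor. *)
have M1 : 0 < `|M| + 1 by rewrite ltr_wpDl.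
near=> z' k => zk; apply: Jdlt.
have [z'ab z'min] := zeta_min k.
rewrite zk in z'ab z'min.
have ek : (e k <= (dlt / 3)%:E)%E.
  apply: ltW; near: k.
  apply: (e0 [set x | x < (dlt / 3)%:E]%E); apply: open_nbhs_nbhs.
  by split; [exact: open_ereal_lt_ereal | rewrite /= lte_fin divr_gt0].
have Mz : M * `|z - z'| <= dlt / 3.
  have zz' : `|z - z'| < dlt / 3 / (`|M| + 1).
    by near: z'; apply: cvgr_dist_lt => //; rewrite !divr_gt0.
  rewrite ltr_pdivlMr// in zz'.
  have := ler_norm M; have := normr_ge0 (z - z'); nra.
(* Pass from [J z] to [J_ k z'], then to [J_ k zeta] by minimality, then to [J zeta]. The cost is
   [e k] twice and [M * |z - z'|] once, hence the thirds of [dlt]. *)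
apply: le_trans (JJ_ k z z' z'ab) _.
apply: le_trans (leeD2r _ (z'min zeta zab)) _.
apply: le_trans (leeD2r _ (J_J k zeta zab)) _.
rewrite -addeA leeD2l//.
have -> : dlt%:E = ((dlt / 3)%:E + ((dlt / 3)%:E + (dlt / 3)%:E))%E.
  by rewrite -!EFinD; congr EFin; lra.
by rewrite !leeD// lee_fin.
Unshelve. all: by end_near.
Qed.

End argmin.

(** * Least-squares distances as functions of the coefficient *)

Section least_squares.
Context d (T : measurableType d) (R : realType).
Variable mu : {measure set T -> \bar R}.
Local Notation "'N2[ f ]" := ('N[mu]_2%:E[EFin \o f%R])%E (at level 0).

(** Measurability is asked of [f_ k - f], where a term common to [f_ k] and [f] cancels. The
    triangle inequality supplies both bounds of [cvg_argmin]. *)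
Lemma cvg_argmin_least_squares (c a b zeta : R) (f g : T -> R)
    (f_ g_ : nat -> T -> R) (zeta_ : nat -> R) :
  (forall k, measurable_fun setT (f_ k \- f)) ->
  'N2[(f_ k \- f)] @[k --> \oo] --> 0%E ->
  (forall k, g_ k \in Lfun mu 2%:E) -> g \in Lfun mu 2%:E ->
  'N2[(g_ k \- g)] @[k --> \oo] --> 0%E ->
  unique_minimizer a b
    (fun z => 'N2[fun x => f x - c * z * g x] ^+ 2)%E zeta ->
  (forall k, minimizer a b
    (fun z => 'N2[fun x => f_ k x - c * z * g_ k x] ^+ 2)%E (zeta_ k)) ->
  zeta_ k @[k --> \oo] --> zeta.
Proof.
move=> mf f0 Lg_ Lg g0 uniq zeta_min.
have l12 : (1 <= 2%:E :> \bar R)%E by rewrite lee_fin ler1n.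
have l12R : (1 <= 2 :> R) by rewrite ler1n.
have N2Z u s : u \in Lfun mu 2%:E -> 'N2[fun x => s * u x] = (`|s|%:E * 'N2[u])%E.
  by move=> Lu; have := LnormZ (Lfun_Sub l12 Lu) s.
have mLfun u : u \in Lfun mu 2%:E -> measurable_fun setT u.
  by move=> /sub_Lfun_mfun/[!inE].
have N2fin : 'N2[g] = (fine 'N2[g])%:E.
  rewrite fineK// ge0_fin_numE ?Lnorm_ge0//.
  by have /sub_Lfun_finLfun/[!inE] := Lg.
have Lgg k : g_ k \- g \in Lfun mu 2%:E.
  exact: (Lfun_addr_closed mu l12).2 (Lg_ k) (Lfun_oppr_closed Lg).
have eq_le (s t : R) : s = t -> s <= t by move=> ->.
(* [B] bounds the coefficient of [g] over the whole interval, so the error [e k] does not depend on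
   [z]. *)
pose B := `|c| * Num.max `|a| `|b|.
have cB z : z \in `[a, b] -> `|c * z| <= B.
  rewrite in_itv/= => /andP[az zb]; rewrite normrM ler_wpM2l//.
  by rewrite le_max; have [z0|z0] := lerP 0 z; apply/orP; [right|left];
    rewrite ?(ger0_norm z0) ?(ltr0_norm z0) ler_normr; apply/orP;
    [left|right]; rewrite ?lerN2.
pose e k := ('N2[(f_ k \- f)] + B%:E * 'N2[(g_ k \- g)])%E.
apply: (@cvg_argmin _ a b (fun z => 'N2[fun x => f x - c * z * g x])
  (fun k z => 'N2[fun x => f_ k x - c * z * g_ k x]) e
  (`|c| * fine 'N2[g]) zeta zeta_).
(* Three moves: from [z] to [z'], with Lipschitz constant [|c|] times the norm of [g], then from [f]
   to [f_ k], then from [g] to [g_ k]. *)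
- move=> k z z' z'ab.
  have h1 : ('N2[fun x => (f x - c * z * g x)] <=
      'N2[fun x => (f x - c * z' * g x)] + (`|c| * fine 'N2[g] * `|z - z'|)%:E)%E.
    have -> : (`|c| * fine 'N2[g] * `|z - z'|)%:E = 'N2[fun x => c * (z - z') * g x].
      by rewrite N2Z// [in RHS]N2fin -EFinM normrM mulrAC.
    apply: Lnorm_le_add_measurable => //.
      by apply: measurable_funM => //; exact: mLfun.
    move=> x; rewrite (le_trans _ (ler_normB _ _))//.
    by apply: eq_le; congr (`| _ |); lra.
  apply: le_trans h1 _; rewrite addeA; apply: leeD2r.
  have h2 : ('N2[fun x => (f x - c * z' * g x)] <=
      'N2[fun x => (f_ k x - c * z' * g x)] + 'N2[(f_ k \- f)])%E.
    apply: Lnorm_le_add_measurable => //.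
    move=> x; rewrite (le_trans _ (ler_normB _ _))//.
    by apply: eq_le; congr (`| _ |) => /=; lra.
  have h3 : ('N2[fun x => (f_ k x - c * z' * g x)] <=
      'N2[fun x => (f_ k x - c * z' * g_ k x)] +
      B%:E * 'N2[(g_ k \- g)])%E.
    apply: (@le_trans _ _ ('N2[fun x => (f_ k x - c * z' * g_ k x)] +
      'N2[fun x => c * z' * (g_ k \- g) x])%E).
      apply: Lnorm_le_add_measurable => //.
        by apply: measurable_funM => //; exact: mLfun.
      move=> x; rewrite (le_trans _ (ler_normD _ _))//.
      by apply: eq_le; congr (`| _ |) => /=; lra.
    by rewrite leeD2l// N2Z// lee_wpmul2r ?Lnorm_ge0// lee_fin cB.
  by rewrite (le_trans h2)// [e k]addeC addeA leeD2r.
- move=> k z zab.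
  have h2 : ('N2[fun x => (f_ k x - c * z * g x)] <=
      'N2[fun x => (f x - c * z * g x)] + 'N2[(f_ k \- f)])%E.
    apply: Lnorm_le_add_measurable => //.
    move=> x; rewrite (le_trans _ (ler_normD _ _))//.
    by apply: eq_le; congr (`| _ |) => /=; lra.
  have h3 : ('N2[fun x => (f_ k x - c * z * g_ k x)] <=
      'N2[fun x => (f_ k x - c * z * g x)] + B%:E * 'N2[(g_ k \- g)])%E.
    apply: (@le_trans _ _ ('N2[fun x => (f_ k x - c * z * g x)] +
      'N2[fun x => c * z * (g_ k \- g) x])%E).
      apply: Lnorm_le_add_measurable => //.
        by apply: measurable_funM => //; exact: mLfun.
      move=> x; rewrite (le_trans _ (ler_normB _ _))//.
      by apply: eq_le; congr (`| _ |) => /=; lra.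
    by rewrite leeD2l// N2Z// lee_wpmul2r ?Lnorm_ge0// lee_fin cB.
  by rewrite (le_trans h3)// /e addeA leeD2r.
- rewrite -[X in _ --> X]adde0 -[X in (_ + X)%E](mule0 B%:E).
  by apply: cvgeD => //; exact: cvgeZl.
- move=> z; rewrite -uniq.
  by split=> /minimizer_sqr; apply=> x; exact: Lnorm_ge0.
- move=> k; have /minimizer_sqr := zeta_min k.
  by apply=> x; exact: Lnorm_ge0.
Qed.

(** The fixed term [q] is absorbed into the data: [q - f_ k] and [q - f] differ by [-(f_ k - f)],
    whose norm is that of [f_ k - f]. *)
Lemma cvg_argmin_residual (q : T -> R) (c a b zeta : R) (f g : T -> R)
    (f_ g_ : nat -> T -> R) (zeta_ : nat -> R) :
  (forall k, measurable_fun setT (f_ k \- f)) ->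
  'N2[(f_ k \- f)] @[k --> \oo] --> 0%E ->
  (forall k, g_ k \in Lfun mu 2%:E) -> g \in Lfun mu 2%:E ->
  'N2[(g_ k \- g)] @[k --> \oo] --> 0%E ->
  unique_minimizer a b
    (fun z => 'N2[fun x => q x - f x - c * z * g x] ^+ 2)%E zeta ->
  (forall k, minimizer a b
    (fun z => 'N2[fun x => q x - f_ k x - c * z * g_ k x] ^+ 2)%E (zeta_ k)) ->
  zeta_ k @[k --> \oo] --> zeta.
Proof.
move=> mf f0; have fE k : (q \- f_ k) \- (q \- f) = \- (f_ k \- f).
  by apply/funext => x /=; lra.
apply: (@cvg_argmin_least_squares c a b zeta (q \- f) g (fun k => q \- f_ k)).
  by move=> k; rewrite fE; exact: measurableT_comp.
rewrite (_ : (fun k => _) = (fun k => 'N2[(f_ k \- f)]))//.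
by apply/funext => k; rewrite fE -[RHS]oppe_Lnorm.
Qed.

End least_squares.

(** * Application to cloaking and shielding *)

Lemma cvg_L2_measurable_funB {R : realType} (Omega : set (plane R))
    (f_ : (plane R -> R)^nat) (f : plane R -> R) k :
  cvg_L2 Omega f_ f ->
  measurable_fun [set: caratheodory_type (arc_length_outer Omega)] (f_ k \- f).
Proof.
move=> [/(_ k)/sub_Lfun_mfun/[!inE] mf_ /sub_Lfun_mfun/[!inE] mf _].
exact: measurable_funB.
Qed.

Theorem theorem4p2 (R : realType) (alpha : R) (halpha : 0 < alpha < 1)
    (Omega D : set (plane R))
    (hOmega : C1_holder_domain alpha Omega) (hbounded : bounded_set Omega)
    (hD : C1_holder_domain alpha D) (hDOmega : closure D `<=` Omega)
    (H P : plane R -> R)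
    (hH : harmonic_on setT H) (hP : harmonic_on setT P)
    (a b c d : R)
    (phi : plane R -> R) (hphi : electric_potential D H phi) :
  (forall (p : plane R -> R) (zeta : R) (phi_ p_ : nat -> plane R -> R)
      (zeta_ : nat -> R),
    cloaking_pressure Omega D P p ->
    unique_minimizer a b (cloaking_functional Omega P phi p) zeta ->
    cvg_normal_derivative 0^'- Omega p_ p ->
    cvg_normal_derivative 0^' Omega phi_ phi ->
    (forall k, minimizer a b (cloaking_functional Omega P (phi_ k) (p_ k))
                 (zeta_ k)) ->
    zeta_ k @[k --> \oo] --> zeta) /\
  (forall (p : plane R -> R) (zeta : R) (phi_ p_ : nat -> plane R -> R)
      (zeta_ : nat -> R),
    shielding_pressure Omega P p ->
    unique_minimizer c d (shielding_functional Omega phi p) zeta ->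
    cvg_normal_derivative 0^'+ Omega p_ p ->
    cvg_normal_derivative 0^' Omega phi_ phi ->
    (forall k, minimizer c d (shielding_functional Omega (phi_ k) (p_ k))
                 (zeta_ k)) ->
    zeta_ k @[k --> \oo] --> zeta).
Proof.
split=> p zeta phi_ p_ zeta_ _ uniq [_ cp] [_ [Lphi_ Lphi phi0]] zmin.
  (* Cloaking: the fixed term [q] is the normal derivative of [P]. *)
  exact: (@cvg_argmin_residual _ _ _ (arc_length Omega)
    (normal_derivative 0^' Omega P) 12 a b zeta
    (normal_derivative 0^'- Omega p) (normal_derivative 0^' Omega phi)
    (fun k => normal_derivative 0^'- Omega (p_ k))
    (fun k => normal_derivative 0^' Omega (phi_ k)) zeta_
    (fun k => cvg_L2_measurable_funB _ _ _ k cp) (let: And3 _ _ p0 := cp in p0)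
    Lphi_ Lphi phi0 uniq zmin).
(* Shielding has no background term in its residual, so [f] is the exterior normal derivative of [p]
   itself. *)
exact: (@cvg_argmin_least_squares _ _ _ (arc_length Omega) 12 c d zeta
  (normal_derivative 0^'+ Omega p) (normal_derivative 0^' Omega phi)
  (fun k => normal_derivative 0^'+ Omega (p_ k))
  (fun k => normal_derivative 0^' Omega (phi_ k)) zeta_
  (fun k => cvg_L2_measurable_funB _ _ _ k cp) (let: And3 _ _ p0 := cp in p0)
  Lphi_ Lphi phi0 uniq zmin).
Qed.
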